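(* Let $\{X, X_{k,i};\ i \geq 1, k \geq 1\}$ be a double array of i.i.d. real-valued random variables such that $\mathbb{E}X = 0$ and $\mathbb{E}X^2 = 1$. Let $\{X', X'_{k,i};\ i \geq 1, k \geq 1\}$ be an independent copy of $\{X, X_{k,i};\ i \geq 1, k \geq 1\}$. Write $\hat{X} = X - X'$ and $\hat{X}_{k,i} = X_{k,i} - X'_{k,i}$, $i \geq 1, k \geq 1$. If, for some constant $0 < a < \infty$, $$\lim_{n \to \infty} n\,\mathbb{P}\left( \left( \frac{n}{\log n} \right)^{1/2} \frac{\left| \sum_{k=1}^{n} X_{k,1} X_{k,2} \right|}{\sqrt{\sum_{k=1}^{n} X_{k,1}^2}\,\sqrt{\sum_{k=1}^{n} X_{k,2}^2}} > a \right) = 0,$$ then $$\lim_{n \to \infty} n\,\mathbb{P}\left( \left( \frac{n}{\log n} \right)^{1/2} \frac{\left| \sum_{k=1}^{n} \hat{X}_{k,1} \hat{X}_{k,2} \right|}{\sqrt{\sum_{k=1}^{n} \hat{X}_{k,1}^2}\,\sqrt{\sum_{k=1}^{n} \hat{X}_{k,2}^2}} > 8a \right) = 0.$$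
   Context: $\log$ is the natural logarithm. An independent copy of a family of random variables is a family independent of it and with the same joint distribution. A ratio whose denominator vanishes is taken to be $0$. *)

(* Defs.v *)
From HB Require Import structures.
From mathcomp Require Import all_boot all_order all_algebra.
From mathcomp Require Import all_classical all_reals all_analysis.

Set Implicit Arguments.
Unset Strict Implicit.
Unset Printing Implicit Defensive.

Import Order.TTheory GRing.Theory Num.Theory.
Import numFieldNormedType.Exports.

Local Open Scope classical_set_scope.
Local Open Scope ring_scope.

Definition mutually_independent (d : measure_display) (T : measurableType d)
    (R : realType) (P : probability T R) (I : choiceType)
    (Y : I -> {RV P >-> R}) : Prop :=
  forall (s : seq I) (B : I -> set R), uniq s ->
    (forall i, measurable (B i)) ->
    P (\bigcap_(i in [set` s]) (Y i @^-1` B i)) =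
    (\prod_(i <- s) P (Y i @^-1` B i))%E.

(* Two measures are compared on measurable sets only: in the library a measure
   is a function on all sets, with arbitrary values on non-measurable ones. *)
Definition identically_distributed (d : measure_display) (T : measurableType d)
    (R : realType) (P : probability T R) (I : Type)
    (Y : I -> {RV P >-> R}) : Prop :=
  forall (i j : I) (B : set R), measurable B ->
    distribution P (Y i) B = distribution P (Y j) B.

Definition iid (d : measure_display) (T : measurableType d)
    (R : realType) (P : probability T R) (I : choiceType)
    (Y : I -> {RV P >-> R}) : Prop :=
  mutually_independent Y /\ identically_distributed Y.

Definition generated_sigma (U : Type) (R : realType) (I : Type)
    (Y : I -> U -> R) : set (set U) :=
  <<s [set A | exists i (B : set R), measurable B /\ A = Y i @^-1` B] >>.

Definition independent_families (d : measure_display) (T : measurableType d)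
    (R : realType) (P : probability T R) (I J : Type)
    (Y : I -> {RV P >-> R}) (Z : J -> {RV P >-> R}) : Prop :=
  forall A B : set T,
    generated_sigma (fun i => Y i : T -> R) A ->
    generated_sigma (fun j => Z j : T -> R) B ->
    P (A `&` B) = (P A * P B)%E.

(* The joint laws are compared on the product sigma-algebra of R^I, i.e. the one
   generated by the coordinate maps. *)
Definition same_joint_distribution (d : measure_display) (T : measurableType d)
    (R : realType) (P : probability T R) (I : Type)
    (Y Z : I -> {RV P >-> R}) : Prop :=
  forall C : set (I -> R),
    generated_sigma (fun (i : I) (x : I -> R) => x i) C ->
    P [set w | C (fun i => Y i w)] = P [set w | C (fun i => Z i w)].

Definition independent_copy (d : measure_display) (T : measurableType d)
    (R : realType) (P : probability T R) (I : Type)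
    (Y Z : I -> {RV P >-> R}) : Prop :=
  independent_families Y Z /\ same_joint_distribution Y Z.

(* The family {X, X_{k,i}} as a single indexed family. Arrays are indexed from 0:
   [Xs k i] stands for X_{k+1,i+1}. *)
Definition adjoin (V : Type) (X : V) (Xs : nat -> nat -> V)
    (o : option (nat * nat)) : V :=
  if o is Some ki then Xs ki.1 ki.2 else X.

(* Since x / 0 = 0, the value is 0 when the denominator vanishes. *)
Definition abs_corr (T : Type) (R : realType) (Y : nat -> nat -> T -> R)
    (n : nat) (w : T) : R :=
  `| \sum_(k < n) Y k 0%N w * Y k 1%N w | /
  (Num.sqrt (\sum_(k < n) Y k 0%N w ^+ 2) *
   Num.sqrt (\sum_(k < n) Y k 1%N w ^+ 2)).

(* Main.v *)
(* The product of two differences expands into four products, and the sum of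
   squares of a difference into two sums of squares and a cross term. So the
   statement involves six sums U(u, v) = sum_k u_k v_k, where u and v are two of
   the four columns X_{.,1}, X_{.,2}, X'_{.,1}, X'_{.,2}. All entries are i.i.d.,
   so the correlation of any two columns has the same law, and off an event of
   probability o(1/n) all six satisfy |U(u, v)| <= (a / r) |u| |v| with
   r = sqrt(n / log n). Once r >= 2a the two cross terms take away at most half of
   the sum of squares, hence |u| + |u'| <= 2 |u - u'|, and the four products give
   r |U(hat X_1, hat X_2)| <= 4a |hat X_1| |hat X_2|. *)
Require Import Defs.
From HB Require Import structures.
From mathcomp Require Import all_boot all_order all_algebra.
From mathcomp Require Import all_classical all_reals all_analysis.
From mathcomp Require Import ring lra.

Set Implicit Arguments.
Unset Strict Implicit.
Unset Printing Implicit Defensive.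

Import Order.TTheory GRing.Theory Num.Theory.
Import numFieldNormedType.Exports.

Local Open Scope classical_set_scope.
Local Open Scope ring_scope.

(** * Deterministic inequalities *)

(** Clearing the denominator is safe even when it vanishes: one column is then zero, so the
    numerator is zero too and, as [0 <= c], both sides are false. *)
Lemma ltr_abs_corr (T : Type) (R : realType) (Y : nat -> nat -> T -> R)
    (n : nat) (w : T) (r c : R) : 0 <= c ->
  (c < r * abs_corr Y n w) =
  (c * (Num.sqrt (\sum_(k < n) Y k 0%N w ^+ 2) *
        Num.sqrt (\sum_(k < n) Y k 1%N w ^+ 2)) <
   r * `|\sum_(k < n) Y k 0%N w * Y k 1%N w|).
Proof.
move=> c0; rewrite /abs_corr.
have S0 i : 0 <= \sum_(k < n) Y k i w ^+ 2 by apply: sumr_ge0 => k _; exact: sqr_ge0.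
have [D0|D0] := eqVneq (Num.sqrt (\sum_(k < n) Y k 0%N w ^+ 2) *
        Num.sqrt (\sum_(k < n) Y k 1%N w ^+ 2)) 0; last first.
  by rewrite mulrA ltr_pdivlMr// lt0r D0 mulr_ge0// sqrtr_ge0.
have -> : \sum_(k < n) Y k 0%N w * Y k 1%N w = 0.
  have S i : Num.sqrt (\sum_(k < n) Y k i w ^+ 2) = 0 ->
      forall k : 'I_n, Y k i w = 0.
    move=> /eqP; rewrite sqrtr_eq0 => Sle k; apply/eqP; rewrite -sqrf_eq0.
    have {}Sle : \sum_(k < n) Y k i w ^+ 2 = 0 by apply/eqP; rewrite eq_le Sle S0.
    by rewrite (psumr_eq0P _ Sle)// => *; exact: sqr_ge0.
  move/eqP: D0; rewrite mulf_eq0 => /orP[] /eqP /S Y0.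
    by apply: big1 => k _; rewrite Y0 mul0r.
  by apply: big1 => k _; rewrite Y0 mulr0.
by rewrite D0 normr0 mul0r !mulr0 ltxx; apply/negbTE; rewrite -leNgt.
Qed.

(* Since [2 * `|W| <= D * D'], the sum of squares [A] of a difference is at least
   half of [D ^+ 2 + D' ^+ 2]. *)
Lemma addr_sqrt_le (R : rcfType) (r a D D' W A : R) :
  0 < a -> 2 * a <= r -> 0 <= D -> 0 <= D' ->
  r * `|W| <= a * (D * D') -> A = D ^+ 2 + D' ^+ 2 - 2 * W ->
  D + D' <= 2 * Num.sqrt A.
Proof.
move=> a0 ar D0 D'0 rW AE.
have W2 : 2 * `|W| <= D * D'.
  rewrite -(ler_pM2l a0); apply: le_trans rW.
  by rewrite mulrA [a * 2]mulrC ler_wpM2r.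
(* Since [8 * W <= 4 * (D * D')], the gap [4 * A - (D + D') ^+ 2] is at least
   [3 * (D - D') ^+ 2]. *)
have hA : (D + D') ^+ 2 <= 4 * A.
  have := ler_norm W; have := sqr_ge0 (D - D'); rewrite AE; nra.
have -> : 2 * Num.sqrt A = Num.sqrt (4 * A).
  rewrite sqrtrM//; congr (_ * _).
  by rewrite (_ : 4 = 2 ^+ 2) ?sqrtr_sqr ?ger0_norm// expr2 -natrM.
by rewrite -[leLHS]ger0_norm ?addr_ge0// -sqrtr_sqr ler_wsqrtr.
Qed.

Section symmetrization.
Variables (R : realType) (n : nat).
Implicit Types x y : nat -> R.

Let U x y := \sum_(k < n) x k * y k.
Let D x := Num.sqrt (\sum_(k < n) x k ^+ 2).

Let D_sqr x : D x ^+ 2 = \sum_(k < n) x k ^+ 2.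
Proof. by rewrite sqr_sqrtr// sumr_ge0// => k _; exact: sqr_ge0. Qed.

Lemma symmetrized_sum_le x0 x1 y0 y1 (r a : R) : 0 < a -> 2 * a <= r ->
  r * `|U x0 x1| <= a * (D x0 * D x1) -> r * `|U y0 y1| <= a * (D y0 * D y1) ->
  r * `|U x0 y1| <= a * (D x0 * D y1) -> r * `|U y0 x1| <= a * (D y0 * D x1) ->
  r * `|U x0 y0| <= a * (D x0 * D y0) -> r * `|U x1 y1| <= a * (D x1 * D y1) ->
  r * `|U (fun k => x0 k - y0 k) (fun k => x1 k - y1 k)| <=
    8 * a * (D (fun k => x0 k - y0 k) * D (fun k => x1 k - y1 k)).
Proof.
move=> a0 ar hxx hyy hxy hyx h0 h1.
have r0 : 0 <= r by lra.
have Dge x : 0 <= D x by exact: sqrtr_ge0.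
have Dhat x y : r * `|U x y| <= a * (D x * D y) ->
    D x + D y <= 2 * D (fun k => x k - y k).
  move=> h; apply: (addr_sqrt_le a0 ar _ _ h) => //.
  rewrite !D_sqr mulr_sumr -big_split -sumrB.
  by apply: eq_bigr => k _; rewrite sqrrB mulr_natl addrAC.
have -> : U (fun k => x0 k - y0 k) (fun k => x1 k - y1 k) =
    U x0 x1 + U y0 y1 - U x0 y1 - U y0 x1.
  by rewrite /U -big_split -!sumrB; apply: eq_bigr => k _ /=; ring.
(* The right-hand sides of the four product bounds add up to exactly this factored form. *)
apply: (@le_trans _ _ (a * ((D x0 + D y0) * (D x1 + D y1)))).
  apply: (@le_trans _ _ (r * (`|U x0 x1| + `|U y0 y1| + `|U x0 y1| + `|U y0 x1|))).
    apply: ler_wpM2l => //; apply: (le_trans (ler_normB _ _)); rewrite lerD2r.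
    by apply: (le_trans (ler_normB _ _)); rewrite lerD2r ler_normD.
  by move: hxx hyy hxy hyx; rewrite !(mulrDl, mulrDr); lra.
have := ler_pM (addr_ge0 (Dge x0) (Dge y0)) (addr_ge0 (Dge x1) (Dge y1))
  (Dhat _ _ h0) (Dhat _ _ h1).
set Da := D (fun k => x0 k - y0 k); set Db := D (fun k => x1 k - y1 k) => h.
have Dab : 0 <= Da * Db by apply: mulr_ge0; exact: Dge.
apply: (@le_trans _ _ (a * (2 * Da * (2 * Db)))); first by rewrite ler_pM2l.
(* The constant reached is [4 * a], relaxed here to [8 * a]. *)
by rewrite mulrACA; nra.
Qed.

End symmetrization.

(** From log n = 2 log(sqrt n) <= 2 sqrt n, the ratio n / log n is at least sqrt n / 2. The
    threshold [K] is chosen so that n >= [K] gives sqrt n >= 2 M^2. *)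
Lemma near_sqrt_div_ln_ge (R : realType) (M : R) :
  \forall n \near \oo, M <= Num.sqrt (n%:R / ln n%:R).
Proof.
pose K : R := (2 * `|M| ^+ 2) ^+ 2.
exists (maxn 2 (Num.bound K)) => // n /=; rewrite geq_max => /andP[n2 Kn].
have nK : K <= n%:R.
  apply: (le_trans (ltW (archi_boundP _))); first by rewrite exprn_ge0.
  by rewrite ler_nat.
have n0 : (0 : R) < n%:R by rewrite ltr0n (leq_trans _ n2).
have ln0 : 0 < ln (n%:R : R) by rewrite ln_gt0// ltr1n.
set s := Num.sqrt (n%:R : R).
have s0 : 0 < s by rewrite sqrtr_gt0.
have nE : n%:R = s ^+ 2 :> R by rewrite sqr_sqrtr// ltW.
have lns : ln (n%:R : R) <= 2 * s.
  by have := ln_sublinear s0; rewrite nE lnXn// (mulr2n (ln s)); lra.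
have sK : 2 * `|M| ^+ 2 <= s.
  rewrite -[leLHS]ger0_norm ?mulr_ge0 ?exprn_ge0// -sqrtr_sqr.
  by rewrite ler_wsqrtr.
apply: (le_trans (ler_norm M)).
rewrite -[leLHS]ger0_norm // -sqrtr_sqr ler_wsqrtr// ler_pdivlMr//.
apply: (le_trans (ler_wpM2l (sqr_ge0 _) lns)).
by rewrite mulrCA mulrA nE expr2 ler_wpM2r// ltW.
Qed.

(** * Joint laws on the product sigma-algebra *)

Section joint_law.
Context (d : measure_display) (T : measurableType d) (R : realType).
Variable P : probability T R.

Lemma measurable_joint (I : Type) (Y : I -> T -> R) (C : set (I -> R)) :
  (forall i, measurable_fun setT (Y i)) ->
  generated_sigma (fun (i : I) (x : I -> R) => x i) C ->
  measurable [set w | C (fun i => Y i w)].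
Proof.
pose G := [set A : set (I -> R) | exists i (B : set R),
  measurable B /\ A = (fun x : I -> R => x i) @^-1` B].
move=> mYi GC.
have mY : measurable_fun setT (fun w => (fun i => Y i w) : g_sigma_algebraType G).
  apply: (@measurability _ _ T (g_sigma_algebraType G) setT _ G) => //.
  move=> _ [_ [i [B [mB ->]]] <-].
  exact: mYi.
by rewrite -[X in measurable X]setTI; exact: mY.
Qed.

(** A pi-system argument: finite-dimensional cylinders are closed under intersection and generate
    the product sigma-algebra, and on a cylinder independence turns both laws into the same product
    of marginals. *)
Lemma same_joint_distributionP (I : choiceType) (Y Z : I -> {RV P >-> R}) :
  mutually_independent Y -> mutually_independent Z ->
  (forall i (B : set R), measurable B -> P (Y i @^-1` B) = P (Z i @^-1` B)) ->
  same_joint_distribution Y Z.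
Proof.
move=> iY iZ YZ C GC.
pose G := [set A : set (I -> R) | exists i (B : set R),
  measurable B /\ A = (fun x : I -> R => x i) @^-1` B].
pose H := [set A : set (I -> R) | exists (s : seq I) (B : I -> set R),
  [/\ uniq s, (forall i, measurable (B i)) &
      A = \bigcap_(i in [set` s]) [set x | B i (x i)]]].
pose S := g_sigma_algebraType G.
have mjoint (V : I -> {RV P >-> R}) : measurable_fun setT (fun w => (fun i => V i w) : S).
  by move=> _ A GA; rewrite setTI; exact: measurable_joint.
have HG : H `<=` @measurable _ S.
  move=> _ [s [B [_ mB ->]]]; apply: fin_bigcap_measurable => // i _.
  by apply: sub_sigma_algebra; exists i, (B i).
have HE : <<s H >> = <<s G >>.
  apply/seteqP; split.
    by apply: smallest_sub => //; exact: (@sigma_algebra_measurable _ S).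
  apply: smallest_sub; first exact: smallest_sigma_algebra.
  move=> _ [i [B [mB ->]]]; apply: sub_sigma_algebra.
  exists [:: i], (fun=> B); split=> //.
  apply/seteqP; split=> [x Bx j /=|x /(_ i)]; last by apply; exact: mem_head.
  by rewrite mem_seq1 => /eqP ->.
have HT : H setT by exists [::], (fun=> setT); split=> //; apply/seteqP; split.
have HI : setI_closed H.
  move=> _ _ [s [B [us mB ->]]] [s' [B' [us' mB' ->]]].
  (* A coordinate that one of the two lists does not constrain gets [setT] from it. *)
  pose E i := (if i \in s then B i else setT) `&` (if i \in s' then B' i else setT).
  exists (undup (s ++ s')), E; split; first exact: undup_uniq.
    by move=> i; apply: measurableI; case: ifP.
  apply/seteqP; split=> x.
    by move=> [xB xB'] i _; split; case: ifPn => // is_; [exact: xB|exact: xB'].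
  by move=> xE; split=> i /= is_; have := xE i;
    rewrite /= mem_undup mem_cat is_ ?orbT /E is_ => /(_ isT)[].
pose joint (V : I -> {RV P >-> R}) : {RV P >-> S} :=
  HB.pack (fun w => (fun i => V i w) : S)
    (isMeasurableFun.Build _ _ T S (fun w => (fun i => V i w) : S) (mjoint V)).
have jointE (V : I -> {RV P >-> R}) (A : set S) :
  distribution P (joint V) A = P [set w | A (fun i => V i w)] by [].
rewrite -!jointE.
apply: (@g_sigma_algebra_measure_unique _ R S H HG (fun=> setT) (fun=> HT)) => //.
- by rewrite bigcup_const.
- move=> A [s [B [us mB ->]]].
  rewrite -[LHS]/(P (\bigcap_(i in [set` s]) (Y i @^-1` B i))).
  rewrite -[RHS]/(P (\bigcap_(i in [set` s]) (Z i @^-1` B i))).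
  by rewrite iY// iZ//; apply: eq_bigr => i _; exact: YZ.
- by move=> k; rewrite [X in (X < _)%E]probability_setT ltry.
- by rewrite HE.
Qed.

End joint_law.

(** * Copies and reindexings of i.i.d. families *)

Section independence.
Context (d : measure_display) (T : measurableType d) (R : realType).
Variable P : probability T R.
Implicit Types I J : choiceType.

Lemma same_joint_distribution_fin I (Y Z : I -> {RV P >-> R}) :
  same_joint_distribution Y Z ->
  forall (s : seq I) (B : I -> set R), (forall i, measurable (B i)) ->
  P (\bigcap_(i in [set` s]) (Y i @^-1` B i)) =
  P (\bigcap_(i in [set` s]) (Z i @^-1` B i)).
Proof.
move=> YZ s B mB; apply: (YZ (\bigcap_(i in [set` s]) [set x | B i (x i)])).
apply: (@fin_bigcap_measurable _ (g_sigma_algebraType _)) => // i _.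
by apply: sub_sigma_algebra; exists i, (B i).
Qed.

Lemma same_joint_distribution_marginal I (Y Z : I -> {RV P >-> R}) :
  same_joint_distribution Y Z ->
  forall i (B : set R), measurable B -> P (Y i @^-1` B) = P (Z i @^-1` B).
Proof.
move=> YZ i B mB; apply: (YZ [set x | B (x i)]).
by apply: sub_sigma_algebra; exists i, B.
Qed.

(** A finite intersection splits by flag into a [Y] block and a [Z] block. Independence of the
    families separates the blocks, and each block factors, [Z] inheriting mutual independence from
    [Y] through the joint law. *)
Lemma independent_copy_iid I (Y Z : I -> {RV P >-> R}) :
  iid Y -> independent_copy Y Z ->
  iid (fun bi : bool * I => if bi.1 then Z bi.2 else Y bi.2).
Proof.
move=> [iY dY] [iYZ YZ]; split; last first.
  have dYZ bi (B : set R) : measurable B ->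
      P ((if bi.1 then Z bi.2 else Y bi.2) @^-1` B) = P (Y bi.2 @^-1` B).
    by move=> mB; case: bi.1 => //; rewrite (same_joint_distribution_marginal YZ).
  move=> bi bj B mB; rewrite -[LHS]/(P (_ @^-1` B)) -[RHS]/(P (_ @^-1` B)).
  by rewrite !dYZ//; exact: dY.
have iZ : mutually_independent Z.
  move=> s B us mB; rewrite -(same_joint_distribution_fin YZ)// iY//.
  by apply: eq_bigr => i _; rewrite (same_joint_distribution_marginal YZ).
move=> s B us mB.
pose part b := [seq bi.2 | bi <- s & bi.1 == b].
have mem_part b i : (i \in part b) = ((b, i) \in s).
  apply/mapP/idP => [[[b' j]]|bis].
    by rewrite mem_filter => /andP[/eqP/= -> js ->].
  by exists (b, i) => //; rewrite mem_filter eqxx.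
have u_part b : uniq (part b).
  rewrite map_inj_in_uniq ?filter_uniq// => -[b1 i1] [b2 i2].
  by rewrite !mem_filter => /andP[/eqP/= -> _] /andP[/eqP/= -> _] ->.
have -> : \bigcap_(bi in [set` s])
      ((if bi.1 then Z bi.2 else Y bi.2) @^-1` B bi) =
    (\bigcap_(i in [set` part false]) (Y i @^-1` B (false, i))) `&`
    (\bigcap_(i in [set` part true]) (Z i @^-1` B (true, i))).
  apply/seteqP; split=> w.
    by move=> h; split=> i /=; rewrite mem_part => /h.
  by move=> [hY hZ] [[] i] /= bis; [apply: hZ|apply: hY]; rewrite /= mem_part.
rewrite iYZ; first 1 last.
- apply: (@fin_bigcap_measurable _ (g_sigma_algebraType _)) => // i _.
  by apply: sub_sigma_algebra; exists i, (B (false, i)).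
- apply: (@fin_bigcap_measurable _ (g_sigma_algebraType _)) => // i _.
  by apply: sub_sigma_algebra; exists i, (B (true, i)).
rewrite iY// iZ// (bigID (fun bi : bool * I => bi.1 == false))/= !big_map !big_filter.
congr (_ * _)%E; first by apply: eq_bigr => -[[] i].
rewrite [RHS](eq_bigl (fun bi : bool * I => bi.1 == true)); last by case=> -[].
by apply: eq_bigr => -[[] i].
Qed.

Lemma iid_reindex I J (W : I -> {RV P >-> R}) (f : J -> I) :
  injective f -> iid W -> iid (W \o f).
Proof.
move=> finj [iW dW]; split=> [s B us mB|]; last by move=> i j; exact: dW.
(* [B] transported along [f]; the value [setT] off the range keeps every [B' i] measurable. *)
pose B' i := if pselect (exists j, f j = i) is left e then B (projT1 (cid e)) else setT.
have B'f j : B' (f j) = B j.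
  rewrite /B'; case: pselect => [e|]; last by case; exists j.
  by case: cid => j' /= /finj ->.
have mB' i : measurable (B' i) by rewrite /B'; case: pselect.
have := iW (map f s) B'; rewrite map_inj_uniq// big_map => /(_ us mB').
under eq_bigr do rewrite B'f.
move=> <-; congr (P _); apply/seteqP; split=> w h.
  by move=> _ /= /mapP[j js ->]; rewrite B'f; exact: h.
by move=> j js; have := h (f j); rewrite /= B'f; apply; exact: map_f.
Qed.

(** This is what makes the correlation events of all pairs of distinct columns equally likely. *)
Lemma iid_same_joint_distribution I J (W : I -> {RV P >-> R}) (f g : J -> I) :
  iid W -> injective f -> injective g ->
  same_joint_distribution (W \o f) (W \o g).
Proof.
move=> iidW finj ginj.
have [iWf _] := iid_reindex finj iidW; have [iWg _] := iid_reindex ginj iidW.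
by apply: same_joint_distributionP => // j B mB; case: iidW => _; apply.
Qed.

End independence.

(** Viewing the event inside R^(nat * bool), with the flag selecting the column, lets equality of
    joint laws apply to it. Without the division it only compares two measurable functions. *)
Lemma generated_sigma_abs_corr (R : realType) (n : nat) (r c : R) : 0 <= c ->
  generated_sigma (fun (j : nat * bool) (x : nat * bool -> R) => x j)
    [set x | c < r * abs_corr (fun k i x => x (k, i == 1%N)) n x].
Proof.
move=> c0.
pose G := [set A : set (nat * bool -> R) | exists j (B : set R),
  measurable B /\ A = (fun x : nat * bool -> R => x j) @^-1` B].
pose S := g_sigma_algebraType G.
have mx j : measurable_fun setT (fun x : S => x j).
  by move=> _ B mB; rewrite setTI; apply: sub_sigma_algebra; exists j, B.
have mD i : measurable_fun setT
    (fun x : S => Num.sqrt (\sum_(k < n) x (k : nat, i) ^+ 2)).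
  apply: measurableT_comp.
    exact: measurable_realfun.continuous_measurable_fun (@sqrt_continuous R).
  by apply: measurable_sum => k; apply: measurable_realfun.measurable_funX; exact: mx.
have mU : measurable_fun setT
    (fun x : S => `|\sum_(k < n) x (k : nat, false) * x (k : nat, true)|).
  apply: measurableT_comp => //.
  by apply: measurable_sum => k; apply: measurable_realfun.measurable_funM; exact: mx.
under eq_set do rewrite ltr_abs_corr//.
have mlt : measurable_fun setT (fun x : S =>
    c * (Num.sqrt (\sum_(k < n) x (k : nat, false) ^+ 2) *
         Num.sqrt (\sum_(k < n) x (k : nat, true) ^+ 2)) <
    r * `|\sum_(k < n) x (k : nat, false) * x (k : nat, true)|).
  apply: measurable_realfun.measurable_fun_ltr;
    apply: measurable_realfun.measurable_funM => //.
  by apply: measurable_realfun.measurable_funM; exact: mD.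
have := mlt measurableT [set true]; rewrite setTI; exact.
Qed.

(** * Union bound over the six correlation events *)

Theorem lemma2p4 (R : realType) (d : measure_display) (T : measurableType d)
    (P : probability T R)
    (X X' : {RV P >-> R}) (Xs Xs' : nat -> nat -> {RV P >-> R})
    (hiid : iid (adjoin X Xs))
    (hmean : ('E_P[X] = 0)%E)
    (hvar : ('E_P[fun w => (X w ^+ 2)%R] = 1)%E)
    (hcopy : independent_copy (adjoin X Xs) (adjoin X' Xs'))
    (a : R) (ha : 0 < a)
    (hlim : (fun n : nat =>
        n%:R%:E *
        P [set w | (Num.sqrt (n%:R / ln n%:R) *
                     abs_corr (fun k i w => Xs k i w) n w > a)%R])%E
      @ \oo --> 0%E) :
  (fun n : nat =>
      n%:R%:E *
      P [set w | (Num.sqrt (n%:R / ln n%:R) *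
                   abs_corr (fun k i w => Xs k i w - Xs' k i w) n w > 8 * a)%R])%E
    @ \oo --> 0%E.
Proof.
pose r n : R := Num.sqrt (n%:R / ln n%:R).
pose W (bi : bool * option (nat * nat)) :=
  if bi.1 then adjoin X' Xs' bi.2 else adjoin X Xs bi.2.
have iidW : iid W by exact: independent_copy_iid.
(* A column is given by a flag, true for the independent copy, and its index. *)
pose col (u : bool * nat) k := W (u.1, Some (k, u.2)).
pose corr_gt (u v : bool * nat) n :=
  [set w | a < r n * abs_corr (fun k i => if i == 1%N then col v k else col u k) n w].
have corr_gtE u v n : u != v ->
    measurable (corr_gt u v n) /\
    P (corr_gt u v n) = P (corr_gt (false, 0%N) (false, 1%N) n).
  move=> uv.
  (* [f u v] embeds a two-column array into the indices of [W]; distinctness of [u] and [v] is what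
     makes it injective. *)
  pose f (u v : bool * nat) (ki : nat * bool) :=
    let t := if ki.2 then v else u in (t.1, Some (ki.1, t.2)).
  have finj u' v' : u' != v' -> injective (f u' v').
    case: u' v' => [b i] [b' i'] uv' [k [|]] [k' [|]] /= []; try by move=> ->.
      by move=> eb _ ei; rewrite eb ei eqxx in uv'.
    by move=> eb _ ei; rewrite eb ei eqxx in uv'.
  have E u' v' : corr_gt u' v' n = [set w | [set x | a < r n *
      abs_corr (fun k i x => x (k, i == 1%N)) n x] (fun ki => (W \o f u' v') ki w)].
    by [].
  have gen := generated_sigma_abs_corr n (r n) (ltW ha).
  split; first by rewrite E; exact: measurable_joint.
  rewrite !E; apply: (iid_same_joint_distribution iidW _ _ gen); first exact: finj.
  exact: (finj (false, 0%N) (false, 1%N)).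
(* [corr_gt (false, 0) (false, 1) n] unfolds to the event of [hlim]; the factor 6 counts the pairs
   of columns. *)
have p_to0 : ((fun n => 6%:R%:E *
    (n%:R%:E * P (corr_gt (false, 0%N) (false, 1%N) n))) @ \oo --> 0)%E.
  rewrite -[0%E](mule0 6%:R%:E); exact: cvgeZl.
apply: (squeeze_cvge _ (cvg_cst 0%E) p_to0).
near=> n.
rewrite mule_ge0//= muleCA lee_wpmul2l//.
set hat_gt := [set w | _].
have mhat : measurable hat_gt.
  have c0 : 0 <= 8 * a by rewrite mulr_ge0// ltW.
  apply: (measurable_joint
    (Y := fun (j : nat * bool) w => Xs j.1 j.2 w - Xs' j.1 j.2 w) _
    (generated_sigma_abs_corr n (r n) c0)) => j.
  exact: measurable_realfun.measurable_funB.
pose pairs : seq ((bool * nat) * (bool * nat)) :=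
  [:: ((false, 0%N), (false, 1%N)); ((true, 0%N), (true, 1%N));
      ((false, 0%N), (true, 1%N)); ((true, 0%N), (false, 1%N));
      ((false, 0%N), (true, 0%N)); ((false, 1%N), (true, 1%N))].
(* The default of [nth] is itself a pair of distinct columns, so [EP] holds for every [j], beyond
   the six pairs as well. *)
pose E (j : nat) :=
  let uv := nth ((false, 0%N), (false, 1%N)) pairs j in corr_gt uv.1 uv.2 n.
have EP j : measurable (E j) /\ P (E j) = P (corr_gt (false, 0%N) (false, 1%N) n).
  by apply: corr_gtE; move: j; do 6 ?case=> //; case.
have sub : hat_gt `<=` \big[setU/set0]_(j < 6) E j.
  have -> : \big[setU/set0]_(j < 6) E j =
      \big[setU/set0]_(uv <- pairs) corr_gt uv.1 uv.2 n.
    by rewrite (big_nth ((false, 0%N), (false, 1%N))) big_mkord.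
  (* By contraposition: at a point outside all six events, the six deterministic bounds hold. *)
  move=> w; rewrite /hat_gt/= -bigcup_seq; apply: contraPP => hw.
  have h uv : uv \in pairs -> ~ corr_gt uv.1 uv.2 n w.
    by move=> uvp cw; apply: hw; exists uv.
  apply/negP; rewrite ltr_abs_corr ?mulr_ge0 ?ltW// -leNgt.
  have hle u v : (u, v) \in pairs ->
      r n * `|\sum_(k < n) col u k w * col v k w| <=
      a * (Num.sqrt (\sum_(k < n) col u k w ^+ 2) *
           Num.sqrt (\sum_(k < n) col v k w ^+ 2)).
    move=> uvp; rewrite leNgt; apply/negP => lt_uv; apply: (h _ uvp).
    by rewrite /corr_gt/= ltr_abs_corr// ltW.
  apply: (@symmetrized_sum_le R n (fun k => Xs k 0%N w) (fun k => Xs k 1%N w)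
    (fun k => Xs' k 0%N w) (fun k => Xs' k 1%N w) (r n) a ha).
  - by near: n; exact: near_sqrt_div_ln_ge.
  - exact: (hle (false, 0%N) (false, 1%N)).
  - exact: (hle (true, 0%N) (true, 1%N)).
  - exact: (hle (false, 0%N) (true, 1%N)).
  - exact: (hle (true, 0%N) (false, 1%N)).
  - exact: (hle (false, 0%N) (true, 0%N)).
  - exact: (hle (false, 1%N) (true, 1%N)).
have mU : measurable (\big[setU/set0]_(j < 6) E j).
  by apply: bigsetU_measurable => j _; exact: (EP j).1.
apply: (@le_trans _ _ (P (\big[setU/set0]_(j < 6) E j))).
  by apply: le_measure => //; rewrite inE.
apply: (le_trans (Boole_inequality P _)) => [j _|]; first exact: (EP j).1.
rewrite (eq_bigr (fun=> P (corr_gt (false, 0%N) (false, 1%N) n))); last first.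
  by move=> j _; exact: (EP j).2.
by rewrite big_const_ord iter_addr addr0 mule_natl.
Unshelve. all: by end_near.
Qed.
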